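(* Let $\xi\sim N(\mu,\Sigma)$ be a jointly distributed Gaussian random vector in $\mathbb{R}^n$ with mean $\mu$ and positive definite covariance matrix $\Sigma$, and let $0<\epsilon\le\frac12$. Then the set $$C_{\mu,\Sigma} := \{(a,b,x)\in\mathbb{R}\times\mathbb{R}\times\mathbb{R}^n : \mathbb{P}(a\le x^T\xi\le b)\ge 1-\epsilon\}$$ is convex. *)

(* Defs.v *)
From HB Require Import structures.
From mathcomp Require Import all_boot all_order all_algebra.
From mathcomp Require Import all_classical all_reals all_analysis.

Set Implicit Arguments.
Unset Strict Implicit.
Unset Printing Implicit Defensive.

Import Order.TTheory GRing.Theory Num.Theory.
Import numFieldNormedType.Exports.

Local Open Scope classical_set_scope.
Local Open Scope ring_scope.

Definition posdefmx (R : realType) (n : nat) (S : 'M[R]_n) : Prop :=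
  S^T = S /\ forall x : 'cV[R]_n, x != 0 -> 0 < (x^T *m S *m x) 0 0.

(* The law N(m, s^2) on the line, s >= 0.  The library's [normal_prob m 0] is
   the uniform law on [0, 1], whence the separate case: N(m, 0) is the point
   mass at m. *)
Definition gaussian_law (R : realType) (m s : R) (A : set R) : \bar R :=
  if s == 0 then \d_m A else normal_prob m s A.

Definition gaussian_rv d (T : measurableType d) (R : realType)
    (P : probability T R) (X : T -> R) : Prop :=
  exists m s : R, 0 <= s /\
    forall A : set R, measurable A -> P (X @^-1` A) = gaussian_law m s A.

(* A random vector is the family of its coordinates, random variables on a
   common probability space; [dotrv xi x] is x^T xi. *)
Definition dotrv d (T : measurableType d) (R : realType)
    (P : probability T R) (n : nat) (xi : 'I_n -> {RV P >-> R})
    (x : 'cV[R]_n) (w : T) : R :=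
  (x^T *m \col_(i < n) xi i w) 0 0.

(* xi ~ N(mu, Sigma): every linear combination of the coordinates is univariate
   Gaussian (the coordinates are jointly Gaussian), the mean vector is mu and
   the covariance matrix is Sigma.  The law of a given x^T xi is not prescribed,
   only that it is Gaussian. *)
Definition gaussian_vector d (T : measurableType d) (R : realType)
    (P : probability T R) (n : nat) (xi : 'I_n -> {RV P >-> R})
    (mu : 'cV[R]_n) (Sigma : 'M[R]_n) : Prop :=
  [/\ forall x : 'cV[R]_n, gaussian_rv P (dotrv xi x),
      forall i : 'I_n, 'E_P[xi i]%E = (mu i 0)%:E &
      forall i j : 'I_n, covariance P (xi i) (xi j) = (Sigma i j)%:E].

Definition chance_set d (T : measurableType d) (R : realType)
    (P : probability T R) (n : nat) (xi : 'I_n -> {RV P >-> R}) (eps : R) :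
    set (R^o * R^o * 'cV[R]_n) :=
  [set abx | ((1 - eps)%:E <=
    P [set w | (abx.1.1 <= dotrv xi abx.2 w <= abx.1.2)%R])%E].

(* Main.v *)
(* If x^T xi ~ N(m, s^2), the constraint reads P(a - m <= s Z <= b - m) >= 1 - eps
   with Z standard normal. As 1 - eps >= 1/2, it forces a - m <= 0 <= b - m, and on
   {l <= 0 <= u} the function (l, u) |-> P(l <= Z <= u) = Phi u - Phi l is concave,
   because Phi is concave on [0, +oo[ and Phi (- x) = 1 - Phi x. Passing to the
   perspective, the set of (l, u, s) with P(l <= s Z <= u) >= 1 - eps is convex, and
   it is stable under decreasing s >= 0 since l <= 0 <= u.
   It remains to see that m depends linearly on x and that s is a convex function of x.
   Both follow from first absolute moments alone: m = E[X] by symmetry of Z, and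
   E|X - m| = s E|Z|, so the convexity of s is the triangle inequality in L^1. *)
Require Import Defs.
From mathcomp Require Import all_boot all_order all_algebra.
From mathcomp Require Import all_classical all_reals all_analysis.
From mathcomp Require Import measurable_realfun ring lra.

Set Implicit Arguments.
Unset Strict Implicit.
Unset Printing Implicit Defensive.

Import Order.TTheory GRing.Theory Num.Theory.

Local Open Scope classical_set_scope.
Local Open Scope ring_scope.

(** No sign condition on [s]: [s = 0] yields the constant map, hence the point mass at [m], and
    [- s] yields the same image of the normal law as [s]. *)
Definition affineR {R : realType} (m s : R) :
  measurableTypeR R -> measurableTypeR R := fun z => m + s * z.

(** * Affine images of the standard normal law *)

Section affine_images.
Context {R : realType}.
Local Notation mu := (@lebesgue_measure R).
Local Notation N01 := (@normal_prob R 0 1).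

Lemma measurable_affineR m s :
  measurable_fun [set: measurableTypeR R] (affineR m s).
Proof. by apply: measurable_funD => //; exact: measurable_funM. Qed.

Lemma measurable_preimage_affineR m s (A : set R) :
  measurable A -> measurable (affineR m s @^-1` A).
Proof. by move=> mA; rewrite -[_ @^-1` _]setTI; exact: measurable_affineR. Qed.

(** The right-hand side is itself a measure in [A], so by uniqueness of Lebesgue measure it suffices
    to compare lengths of half-open intervals. *)
Lemma lebesgue_measure_affineR m s (A : set R) : 0 < s -> measurable A ->
  mu A = (s%:E * mu (affineR m s @^-1` A))%E.
Proof.
move=> s0 mA.
pose nu : {measure set (measurableTypeR R) -> \bar R} :=
  mscale (NngNum (ltW s0)) (pushforward mu (affineR m s)).
rewrite [RHS](_ : _ = nu (measurable_affineR m s) A) //.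
apply: lebesgue_measure_unique => //= _ [[a b]] _ <-.
rewrite [RHS]/= /mscale /= /pushforward.
have -> : affineR m s @^-1` `]a, b] = `](a - m) / s, (b - m) / s]%classic.
  apply/seteqP; split => z /=; rewrite !in_itv/= /affineR;
  by rewrite ltr_pdivrMr// ler_pdivlMr// ltrBlDl lerBrDl [z * s]mulrC.
rewrite !lebesgue_measure_itv/= !lte_fin ltr_pM2r ?invr_gt0// ltrD2r.
case: ifP => _; last by rewrite mule0.
by rewrite -!EFinB -EFinM; congr EFin; field; rewrite gt_eqF.
Qed.

Lemma integral_affineR m s (A : set R) (f : R -> \bar R) :
    0 < s -> measurable A -> measurable_fun setT f -> (forall x, 0 <= f x)%E ->
  (\int[mu]_(x in A) f x =
   \int[mu]_(z in affineR m s @^-1` A) (s%:E * f (affineR m s z)))%E.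
Proof.
move=> s0 mA mf f0.
have mfA := measurable_funS measurableT (@subsetT _ A) mf.
have mF := measurable_affineR m s.
pose nu : {measure set (measurableTypeR R) -> \bar R} :=
  mscale (NngNum (ltW s0)) (pushforward mu (affineR m s)).
transitivity (\int[nu mF]_(x in A) f x)%E.
  apply: eq_measure_integral => B mB _.
  exact: lebesgue_measure_affineR.
rewrite ge0_integral_mscale//= ge0_integral_pushforward//.
rewrite ge0_integralZl//; last by rewrite lee_fin ltW.
  exact: measurable_preimage_affineR.
apply: measurable_funTS; apply: measurableT_comp mf _; exact: measurable_affineR.
Qed.

(** Substitute [x = m + s z]: the Jacobian [s] cancels the factor [1 / s] in the peak of the
    density. *)
Lemma normal_prob_affineR m s (A : set R) : 0 < s -> measurable A ->
  normal_prob m s A = N01 (affineR m s @^-1` A).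
Proof.
move=> s0 mA; rewrite /normal_prob (integral_affineR m s0) //; last 2 first.
- by apply/measurable_EFinP; exact: measurable_normal_pdf.
- by move=> x; rewrite lee_fin normal_pdf_ge0.
apply: eq_integral => z _; rewrite -EFinM; congr EFin.
rewrite !normal_pdfE ?oner_eq0 ?gt_eqF//.
rewrite /normal_peak /normal_fun mulrA /affineR; congr (_ * expR _).
  rewrite expr1n mul1r -mulrnAr sqrtrM ?sqr_ge0// sqrtr_sqr ger0_norm ?ltW//.
  by rewrite invfM mulrA divff ?mul1r// gt_eqF.
by field; rewrite gt_eqF.
Qed.

Lemma gaussian_law_affineR (m s : R) (A : set R) : 0 <= s -> measurable A ->
  gaussian_law m s A = N01 (affineR m s @^-1` A).
Proof.
move=> s0 mA; rewrite /gaussian_law.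
case: eqVneq => [->|sN0]; last by apply: normal_prob_affineR; rewrite ?lt_def ?sN0.
rewrite diracE; have -> : affineR m 0 = cst m.
  by apply/funext => z; rewrite /affineR mul0r addr0.
by rewrite preimage_cst; case: ifP => _; rewrite ?probability_setT ?measure0.
Qed.

(** Both the density and Lebesgue measure are invariant under negation. *)
Lemma N01_opp (A : set R) : measurable A ->
  N01 ((-%R : measurableTypeR R -> measurableTypeR R) @^-1` A) = N01 A.
Proof.
move=> mA; rewrite /normal_prob.
transitivity (\int[pushforward mu (-%R : _ -> measurableTypeR R)]_(x in A)
   (normal_pdf 0 1 x)%:E)%E; last first.
  by apply: eq_measure_integral => B mB _; exact: lebesgue_measureN.
rewrite ge0_integral_pushforward//; last 2 first.
- by apply: measurable_funTS; apply/measurable_EFinP; exact: measurable_normal_pdf.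
- by move=> x _; rewrite lee_fin normal_pdf_ge0.
apply: eq_integral => z _ /=; congr EFin.
by rewrite !normal_pdfE ?oner_eq0// /normal_fun !subr0 sqrrN.
Qed.

End affine_images.

(** * Concavity of the standard normal distribution function *)

Section standard_normal_cdf.
Context {R : realType}.
Local Notation mu := (@lebesgue_measure R).
Local Notation N01 := (@normal_prob R 0 1).
Local Notation phi := (@normal_pdf R 0 1).

Definition Phi (x : R) : R := fine (N01 `]-oo, x]).

Lemma PhiE x : N01 `]-oo, x] = (Phi x)%:E.
Proof. by rewrite fineK// fin_num_measure. Qed.

Lemma measurable_phi (A : set R) : measurable_fun A (fun z => (phi z)%:E).
Proof.
by apply: measurable_funTS; apply/measurable_EFinP; exact: measurable_normal_pdf.
Qed.

Lemma normal_prob_segment x y : x <= y -> N01 `[x, y] = (Phi y - Phi x)%:E.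
Proof.
move=> xy; rewrite EFinB -!PhiE; apply/esym/eqP.
rewrite sube_eq ?fin_num_measure//; last first.
  by rewrite fin_num_adde_defl// fin_num_measure.
(* Points are null, so [x] can be given to the segment and the union becomes disjoint. *)
have -> : N01 `]-oo, x] = N01 `]-oo, x[.
  by rewrite /normal_prob integral_itv_bndo_bndc//; apply: measurable_phi.
rewrite -measureU//.
- by rewrite setUC -itv_bndbnd_setU// bnd_simp.
- apply/seteqP; split => // z [] /=; rewrite !in_itv/= => /andP[xz _].
  by rewrite ltNge xz.
Qed.

Lemma phi_gt0 z : 0 < phi z.
Proof.
by rewrite normal_pdfE ?oner_eq0// mulr_gt0 ?expR_gt0// normal_peak_gt0// oner_eq0.
Qed.

Lemma phi_le_norm x y : `|x| <= `|y| -> phi y <= phi x.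
Proof.
move=> xy; rewrite !normal_pdfE ?oner_eq0// ler_wpM2l ?normal_peak_ge0//.
rewrite ler_expR !subr0 !mulNr lerN2 ler_wpM2r ?invr_ge0 ?mulrn_wge0 ?sqr_ge0//.
rewrite -[leLHS]real_normK ?num_real// -[leRHS]real_normK ?num_real//.
by rewrite lerXn2r ?nnegrE.
Qed.

Lemma integral_cst_segment x y c : x <= y ->
  (\int[mu]_(_ in `[x, y]) c%:E = (c * (y - x))%:E)%E.
Proof.
rewrite integral_cst//= lebesgue_measure_itv/= lte_fin EFinM le_eqVlt.
by case/predU1P => [->|->]; rewrite ?ltxx ?subrr ?mule0// EFinB.
Qed.

(** With its companion [Phi_increment_le], this plays the part of the mean value theorem: [Phi] is
    never differentiated. *)
Lemma Phi_increment_ge x y c : x <= y ->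
  (forall z, x <= z <= y -> c <= phi z) -> 0 <= c -> c * (y - x) <= Phi y - Phi x.
Proof.
move=> xy cphi c0; rewrite -lee_fin -normal_prob_segment// /normal_prob.
rewrite -integral_cst_segment//.
apply: ge0_le_integral => //; first exact: measurable_phi.
Qed.

Lemma Phi_increment_le x y c : x <= y ->
  (forall z, x <= z <= y -> phi z <= c) -> Phi y - Phi x <= c * (y - x).
Proof.
move=> xy cphi; rewrite -lee_fin -normal_prob_segment// /normal_prob.
rewrite -integral_cst_segment//.
apply: ge0_le_integral => //.
  by move=> z _; rewrite lee_fin normal_pdf_ge0.
exact: measurable_phi.
Qed.

Lemma ltPhi x y : x < y -> Phi x < Phi y.
Proof.
move=> xy; rewrite -subr_gt0.
(* Every [z] in [[x, y]] satisfies [|z| <= |x| + |y|], so [phi] at that point is a positive lower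
   bound for the density on the segment. *)
apply: (@lt_le_trans _ _ (phi (`|x| + `|y|) * (y - x))).
  by rewrite mulr_gt0 ?phi_gt0// subr_gt0.
apply: Phi_increment_ge; [exact: ltW| |by rewrite ltW// phi_gt0].
move=> z /andP[xz zy]; apply: phi_le_norm.
rewrite [leRHS]ger0_norm ?addr_ge0// ler_norml.
have := ler_norm y; have := ler_norm (- x); rewrite normrN => hx hy.
have x0 := normr_ge0 x; have y0 := normr_ge0 y.
by apply/andP; split; lra.
Qed.

Lemma PhiN x : Phi (- x) = 1 - Phi x.
Proof.
apply/EFin_inj; rewrite EFinB -!PhiE -(@N01_opp _ `]-oo, - x]%classic)//.
have -> : (-%R : measurableTypeR R -> measurableTypeR R) @^-1` `]-oo, (- x)] =
    `[x, +oo[%classic.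
  by apply/seteqP; split => z /=; rewrite !in_itv/= lerN2 ?andbT.
have -> : N01 `]-oo, x] = N01 `]-oo, x[.
  by rewrite /normal_prob integral_itv_bndo_bndc//; apply: measurable_phi.
by rewrite -setCitvl probability_setC.
Qed.

Lemma Phi_le1 x : Phi x <= 1.
Proof. by rewrite -lee_fin -PhiE probability_le1. Qed.

Lemma Phi0 : Phi 0 = 2^-1.
Proof. by have := PhiN 0; rewrite oppr0; lra. Qed.

(** The density decreases on the nonnegative half-line, so [phi z] at the intermediate point [z]
    separates the chord slopes: that over [[x, z]] is at least [phi z], that over [[z, y]] at most
    [phi z]. *)
Lemma Phi_concave x y p q : 0 <= x -> 0 <= y -> 0 <= p -> 0 <= q -> p + q = 1 ->
  p * Phi x + q * Phi y <= Phi (p * x + q * y).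
Proof.
wlog xy : x y p q / x <= y => [hw|] x0 y0 p0 q0 pq1.
  have [xy|/ltW yx] := leP x y; first exact: hw.
  by rewrite addrC [X in _ <= Phi X]addrC; apply: hw => //; rewrite addrC.
set z := p * x + q * y.
have zx : z - x = q * (y - x) by rewrite /z (_ : p = 1 - q); [ring|lra].
have yz : y - z = p * (y - x) by rewrite /z (_ : q = 1 - p); [ring|lra].
have xz : x <= z by rewrite -subr_ge0 zx mulr_ge0// subr_ge0.
have zy : z <= y by rewrite -subr_ge0 yz mulr_ge0// subr_ge0.
have h1 : phi z * (z - x) <= Phi z - Phi x.
  apply: Phi_increment_ge => //; last by rewrite ltW// phi_gt0.
  by move=> t /andP[xt tz]; apply: phi_le_norm; rewrite !ger0_norm//; lra.
have h2 : Phi y - Phi z <= phi z * (y - z).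
  apply: Phi_increment_le => // t /andP[zt ty].
  by apply: phi_le_norm; rewrite !ger0_norm//; lra.
have := ler_wpM2l p0 h1; have := ler_wpM2l q0 h2.
rewrite zx yz => h3 h4.
(* Both sides are compared with [p * q * (y - x) * phi z]. *)
have h5 : q * (Phi y - Phi z) <= p * (Phi z - Phi x).
  apply: le_trans h3 _; apply: le_trans h4.
  by rewrite [leLHS](_ : _ = p * (phi z * (q * (y - x)))) //; ring.
have -> : Phi z = p * Phi z + q * Phi z by rewrite -mulrDl pq1 mul1r.
by move: h5; rewrite !mulrBr; lra.
Qed.

Lemma normal_prob_segment_half l u : ((2^-1)%:E <= N01 `[l, u])%E -> l <= 0 <= u.
Proof.
have [lu|ul] := leP l u; last first.
  rewrite set_itv_ge ?measure0 ?lee_fin; last by rewrite bnd_simp -ltNge.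
  by move=> ?; lra.
rewrite normal_prob_segment// lee_fin => h.
apply/andP; split; rewrite leNgt; apply/negP => /ltPhi.
  by rewrite Phi0; have := Phi_le1 u; lra.
(* These two facts give [0 <= Phi l], so [u < 0] would leave a mass below one half. *)
have := PhiN l; have := Phi_le1 (- l); rewrite Phi0; lra.
Qed.

(** By symmetry the mass is [Phi u + Phi (- l) - 1], a sum of concave functions of the nonnegative
    numbers [u] and [- l]. *)
Lemma normal_prob_segment_concave l1 u1 l2 u2 p q :
    l1 <= 0 <= u1 -> l2 <= 0 <= u2 -> 0 <= p -> 0 <= q -> p + q = 1 ->
  (p%:E * N01 `[l1, u1] + q%:E * N01 `[l2, u2] <=
   N01 `[(p * l1 + q * l2)%R, (p * u1 + q * u2)%R])%E.
Proof.
move=> /andP[l10 u10] /andP[l20 u20] p0 q0 pq1.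
have u0 : 0 <= p * u1 + q * u2 by rewrite addr_ge0 ?mulr_ge0.
have l0 : p * l1 + q * l2 <= 0.
  by rewrite -oppr_ge0 opprD -!mulrN addr_ge0 ?mulr_ge0 ?oppr_ge0.
rewrite !normal_prob_segment ?(le_trans l0 u0) ?(le_trans l10 u10)
  ?(le_trans l20 u20)//.
rewrite -!EFinM -EFinD lee_fin.
have hu := Phi_concave u10 u20 p0 q0 pq1.
have := @Phi_concave (- l1) (- l2) p q.
rewrite !oppr_ge0 => /(_ l10 l20 p0 q0 pq1).
rewrite !mulrN -opprD !PhiN !mulrBr !mulr1; lra.
Qed.

(** * The perspective: segments under a scaled normal law *)

Definition scaled_prob (l u t : R) := N01 [set z | l <= t * z <= u].

Lemma scaled_prob_gt0E l u t : 0 < t ->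
  scaled_prob l u t = N01 `[(l / t)%R, (u / t)%R].
Proof.
move=> t0; congr (N01 _); apply/seteqP; split => z /=;
by rewrite in_itv/= ler_pdivrMr// ler_pdivlMr// [z * t]mulrC.
Qed.

(** This is why [scaled_prob] is written with [t * z]: at [t = 0] the quotients [l / t] and [u / t]
    are both 0 and would always give mass 0. *)
Lemma scaled_prob0E l u : scaled_prob l u 0 = (if (l <= 0 <= u)%R then 1 else 0)%E.
Proof.
rewrite /scaled_prob; case: ifPn => lu.
  rewrite [X in N01 X](_ : _ = setT) ?probability_setT//.
  by apply/seteqP; split => z //= _; rewrite mul0r.
rewrite [X in N01 X](_ : _ = set0) ?measure0//.
by apply/seteqP; split => z //=; rewrite mul0r (negbTE lu).
Qed.

Lemma scaled_prob_half l u t c : 0 <= t -> 2^-1 <= c ->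
  (c%:E <= scaled_prob l u t)%E -> l <= 0 <= u.
Proof.
rewrite le_eqVlt => /predU1P[<-|t0] c2.
  by rewrite scaled_prob0E; case: ifPn => // _; rewrite lee_fin; lra.
rewrite scaled_prob_gt0E// => h.
have /normal_prob_segment_half : ((2^-1)%:E <= N01 `[(l / t)%R, (u / t)%R])%E.
  by apply: le_trans h; rewrite lee_fin.
by rewrite ler_pdivrMr// ler_pdivlMr// mul0r.
Qed.

Lemma scaled_prob_convex l1 u1 t1 l2 u2 t2 t p q c :
    2^-1 <= c <= 1 -> 0 <= t1 -> 0 <= t2 ->
    0 <= p -> 0 <= q -> p + q = 1 -> 0 <= t <= p * t1 + q * t2 ->
    (c%:E <= scaled_prob l1 u1 t1)%E -> (c%:E <= scaled_prob l2 u2 t2)%E ->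
  (c%:E <= scaled_prob (p * l1 + q * l2)%R (p * u1 + q * u2)%R t)%E.
Proof.
move=> /andP[c2 c1] t10 t20 p0 q0 pq1 /andP[t0 tT] h1 h2.
have /andP[l1le u1ge] := scaled_prob_half t10 c2 h1.
have /andP[l2le u2ge] := scaled_prob_half t20 c2 h2.
have uge : 0 <= p * u1 + q * u2 by rewrite addr_ge0 ?mulr_ge0.
have lle : p * l1 + q * l2 <= 0.
  by rewrite -oppr_ge0 opprD -!mulrN addr_ge0 ?mulr_ge0 ?oppr_ge0.
move: t0; rewrite le_eqVlt => /predU1P[<-|t0].
  by rewrite scaled_prob0E lle uge lee_fin.
set T := p * t1 + q * t2 in tT *.
have T0 : 0 < T := lt_le_trans t0 tT.
(* Weights of the perspective: with them [p' * (l1 / t1) + q' * (l2 / t2)] is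
   [(p * l1 + q * l2) / T] when [t1] and [t2] are nonzero. *)
pose p' := p * t1 / T; pose q' := q * t2 / T.
have p'0 : 0 <= p' by rewrite divr_ge0 ?mulr_ge0 ?(ltW T0).
have q'0 : 0 <= q' by rewrite divr_ge0 ?mulr_ge0 ?(ltW T0).
have pq'1 : p' + q' = 1 by rewrite /p' /q' -mulrDl divff// gt_eqF.
(* When [s = 0] the weight [r * s / T] vanishes, so the junk value [x / 0 = 0] is
   harmless and degenerate laws need no separate treatment. *)
have weight r s l u : 0 <= s -> (c%:E <= scaled_prob l u s)%E -> 0 <= r ->
    l <= 0 <= u ->
    ((r * s / T * c)%:E <= (r * s / T)%:E * N01 `[(l / s)%R, (u / s)%R])%E /\
    (r * l / T <= r * s / T * (l / s) /\ r * s / T * (u / s) <= r * u / T).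
  rewrite le_eqVlt => /predU1P[<-|s0] h r0 /andP[l0 u0].
    rewrite !mulr0 !mul0r mul0e lexx; split => //; split.
      by rewrite mulr_le0_ge0 ?invr_ge0 ?(ltW T0) ?mulr_ge0_le0.
    by rewrite divr_ge0 ?mulr_ge0 ?(ltW T0).
  split; last first.
    by split; rewrite le_eqVlt; apply/orP; left; apply/eqP; field; rewrite !gt_eqF.
  rewrite EFinM lee_wpmul2l -?scaled_prob_gt0E//.
  by rewrite lee_fin divr_ge0 ?mulr_ge0 ?(ltW T0) ?(ltW s0).
have [w1 [wl1 wu1]] := weight p t1 l1 u1 t10 h1 p0 (introT andP (conj l1le u1ge)).
have [w2 [wl2 wu2]] := weight q t2 l2 u2 t20 h2 q0 (introT andP (conj l2le u2ge)).
have sgn x y s : 0 <= s -> x <= 0 <= y -> x / s <= 0 <= y / s.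
  move=> s0 /andP[x0 y0]; rewrite divr_ge0// andbT.
  by rewrite -oppr_ge0 -mulNr divr_ge0 ?oppr_ge0.
have := @normal_prob_segment_concave (l1 / t1) (u1 / t1) (l2 / t2) (u2 / t2) p' q'.
rewrite !sgn ?l1le ?l2le// => /(_ isT isT p'0 q'0 pq'1) conc.
rewrite scaled_prob_gt0E//.
apply: (@le_trans _ _ (N01 `[(p' * (l1 / t1) + q' * (l2 / t2))%R,
                             (p' * (u1 / t1) + q' * (u2 / t2))%R])).
  apply: le_trans conc; have -> : c = p' * c + q' * c by rewrite -mulrDl pq'1 mul1r.
  by rewrite EFinD leeD.
(* The averaged segment lies in the combined one divided by [T]; dividing by [t <= T] instead only
   enlarges it, as it contains 0. *)
apply: le_measure; rewrite ?inE//.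
apply: subset_itv; rewrite bnd_simp.
  apply: (@le_trans _ _ ((p * l1 + q * l2) / T)).
    by rewrite ler_wnM2l// lef_pV2.
  by rewrite mulrDl lerD.
apply: (@le_trans _ _ ((p * u1 + q * u2) / T)).
  by rewrite mulrDl lerD.
by rewrite ler_wpM2l// lef_pV2.
Qed.

End standard_normal_cdf.

(** * First absolute moments *)

(* In [\bar R], [+oo - +oo = -oo], so the total integral is finite only if both its
   positive and its negative part are. *)
Lemma integrable_fin_integral (d : measure_display) (T : measurableType d)
    (R : realType) (P : {measure set T -> \bar R}) (f : T -> \bar R) :
  measurable_fun setT f -> (\int[P]_w f w \is a fin_num)%E ->
  P.-integrable setT f.
Proof.
move=> mf; rewrite integralE => fin; apply/integrableP; split => //.
have -> : (fun w => `|f w|%E) = (f^\+ \+ f^\-)%E by rewrite -fune_abse.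
rewrite ge0_integralD//; last 2 first.
- exact: measurable_funepos.
- exact: measurable_funeneg.
have p0 : (0 <= \int[P]_w f^\+ w)%E by exact: integral_ge0.
have n0 : (0 <= \int[P]_w f^\- w)%E by exact: integral_ge0.
move: fin p0 n0.
by case: (\int[P]_w f^\+ w)%E => [a| |] //;
  case: (\int[P]_w f^\- w)%E => [b| |] // *; rewrite -EFinD ltry.
Qed.

Section affine_normal_law.
Context {d : measure_display} {T : measurableType d} {R : realType}.
Variable P : probability T R.
Local Notation N01 := (@normal_prob R 0 1).
Implicit Types (X Y Z : T -> R) (m s : R).

Definition normal_law X m s := forall A : set R, measurable A ->
  P (X @^-1` A) = N01 (affineR m s @^-1` A).

Lemma gaussian_rv_law X : gaussian_rv P X ->
  exists m s, 0 <= s /\ normal_law X m s.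
Proof.
move=> [m [s [s0 h]]]; exists m, s; split => // A mA.
by rewrite h// gaussian_law_affineR.
Qed.

Lemma normal_lawN X m s : normal_law X m s -> normal_law X m (- s).
Proof.
move=> h A mA; rewrite h// -N01_opp; last exact: measurable_preimage_affineR.
by congr (N01 _); apply/seteqP; split => z; rewrite /= /affineR mulrN mulNr.
Qed.

(** Both sides are integrals of [f] against one image measure on the line. *)
Lemma ge0_integral_normal_law X m s (f : R -> \bar R) :
    measurable_fun setT X -> normal_law X m s ->
    measurable_fun setT f -> (forall x, 0 <= f x)%E ->
  (\int[P]_w f (X w) = \int[N01]_z f (affineR m s z))%E.
Proof.
move=> mX XN mf f0.
rewrite -[LHS](@ge0_integral_pushforward _ _ _ (measurableTypeR R) _ X mX P setT f)//.
rewrite -[RHS](@ge0_integral_pushforward _ _ (measurableTypeR R) (measurableTypeR R) _ _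
  (measurable_affineR m s) N01 setT f)//.
apply: eq_measure_integral => [|? A mA _]; [exact: measurable_affineR|exact: XN].
Qed.

(** The finite first moment is carried over from [X], not computed from the Gaussian density. *)
Lemma integrable_affineR X m s : normal_law X m s ->
  P.-integrable setT (EFin \o X) -> N01.-integrable setT (EFin \o affineR m s).
Proof.
move=> XN /integrableP[/measurable_EFinP mX fin]; apply/integrableP; split.
  by apply/measurable_EFinP; exact: measurable_affineR.
move: fin; rewrite (ge0_integral_normal_law (f := fun x => `|x%:E|%E) mX XN)//.
by apply: measurableT_comp => //; exact: measurable_EFin.
Qed.

Lemma integral_normal_law_affine X m s : normal_law X m s ->
  P.-integrable setT (EFin \o X) ->
  (\int[P]_w (X w)%:E = \int[N01]_z (affineR m s z)%:E)%E.
Proof.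
move=> XN iX; have iA := integrable_affineR XN iX.
have /integrableP[/measurable_EFinP mX _] := iX.
rewrite -[LHS](@integral_pushforward _ _ _ (measurableTypeR R) _ X mX P setT EFin)//.
rewrite -[RHS](@integral_pushforward _ _ (measurableTypeR R) (measurableTypeR R) _ _
  (measurable_affineR m s) N01 setT EFin)//.
apply: eq_measure_integral => [|? A mA _]; [exact: measurable_affineR|exact: XN].
Qed.

Lemma normal_law_mean X m s : normal_law X m s ->
  P.-integrable setT (EFin \o X) -> (\int[P]_w (X w)%:E = m%:E)%E.
Proof.
move=> XN iX.
have i1 := integrable_affineR XN iX.
have i2 := integrable_affineR (normal_lawN XN) iX.
have e1 := integral_normal_law_affine XN iX.
have e2 := integral_normal_law_affine (normal_lawN XN) iX.
(* [X] has the law of both [m + s Z] and [m - s Z], whose sum is constant. *)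
have : (\int[P]_w (X w)%:E + \int[P]_w (X w)%:E = (m + m)%:E)%E.
  rewrite {1}e1 e2 -integralD//.
  under eq_integral do rewrite -EFinD /affineR mulNr addrACA subrr addr0.
  by rewrite integral_cst//= [X in (_ * X)%E]probability_setT mule1.
have /fineK <- := integrable_fin_num measurableT iX.
by rewrite -EFinD => -[?]; congr EFin; lra.
Qed.

(** The constant E|Z|. Its value is never computed: being positive and finite is enough to cancel
    it. *)
Definition abs_moment : \bar R := (\int[N01]_z `|z%:E|)%E.

Lemma normal_law_abs_moment X m s : measurable_fun setT X -> normal_law X m s ->
  0 <= s -> (\int[P]_w `|(X w - m)%:E| = s%:E * abs_moment)%E.
Proof.
move=> mX XN s0.
rewrite (ge0_integral_normal_law (f := fun x => `|(x - m)%:E|%E) mX XN)//;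
  last first.
  apply: measurableT_comp => //; apply/measurable_EFinP.
  exact: measurable_funB.
rewrite /abs_moment -ge0_integralZl//; last first.
  by apply: measurableT_comp => //; apply/measurable_EFinP.
by apply: eq_integral => z _; rewrite /affineR addrC addKr -EFinM/= normrM ger0_norm.
Qed.

Lemma abs_moment_gt0 : (0 < abs_moment)%E.
Proof.
rewrite lt_neqAle integral_ge0// andbT; apply/negP => /eqP/esym h.
have /(ae_eq_integral_abs N01 measurableT) :
  measurable_fun setT (EFin : measurableTypeR R -> \bar R) by [].
move=> [/(_ h) [A [mA A0 sA]] _].
(* If E|Z| were 0, then [z = 0] outside the null set [A], which would thus contain [[1, 2]], a
   segment of positive mass. *)
have : (N01 `[1%R, 2%R] <= N01 A)%E.
  apply: le_measure; rewrite ?inE// => z /=; rewrite in_itv/= => /andP[z1 _].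
  by apply: sA => /= /(_ I) [z0]; move: z1; rewrite z0 ler10.
rewrite A0 normal_prob_segment ?ler1n// lee_fin subr_le0 leNgt.
by rewrite ltPhi// ltr1n.
Qed.

Lemma normal_law_combination X Y Z m1 s1 m2 s2 m s p q :
    normal_law X m1 s1 -> normal_law Y m2 s2 -> normal_law Z m s ->
    P.-integrable setT (EFin \o X) -> P.-integrable setT (EFin \o Y) ->
    (forall w, Z w = p * X w + q * Y w) ->
    0 <= s1 -> 0 <= s2 -> 0 <= s -> 0 <= p -> 0 <= q ->
  m = p * m1 + q * m2 /\ s <= p * s1 + q * s2.
Proof.
move=> XN YN ZN iX iY ZE s10 s20 s0 p0 q0.
have iZE : EFin \o Z = (fun w => p%:E * (X w)%:E + q%:E * (Y w)%:E)%E.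
  by apply/funext => w; rewrite /= ZE EFinD !EFinM.
have iZ : P.-integrable setT (EFin \o Z).
  by rewrite iZE; apply: integrableD => //; apply: integrableZl.
have /integrableP[/measurable_EFinP mX _] := iX.
have /integrableP[/measurable_EFinP mY _] := iY.
have /integrableP[/measurable_EFinP mZ Zfin] := iZ.
have mE : m = p * m1 + q * m2.
  apply: EFin_inj; rewrite -(normal_law_mean ZN iZ).
  rewrite -[LHS]/(\int[P]_w (EFin \o Z) w)%E.
  rewrite iZE integralD//; [|exact: integrableZl..].
  rewrite !integralZl//.
  by rewrite (normal_law_mean XN iX) (normal_law_mean YN iY).
(* A degenerate [Z] says nothing about [abs_moment], but then the bound is mere nonnegativity. *)
split => //; move: s0; rewrite le_eqVlt => /predU1P[<-|s0].
  by rewrite addr_ge0// mulr_ge0.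
have mabs (W : T -> R) c : measurable_fun setT W ->
    measurable_fun setT (fun w => `|(W w - c)%:E|%E).
  move=> mW; apply: measurableT_comp => //; apply/measurable_EFinP.
  exact: measurable_funB.
have absZ := normal_law_abs_moment mZ ZN (ltW s0).
(* Read off from [Z], which is integrable and has [s > 0]. *)
have abs_fin : abs_moment \is a fin_num.
  have iZm : P.-integrable setT (fun w => (Z w)%:E - m%:E)%E.
    by apply: integrableB => //; apply: finite_measure_integrable_cst.
  have /integrableP[_ /=] := iZm; rewrite absZ.
  have := abs_moment_gt0; case: abs_moment => // _.
  by rewrite gt0_muley ?lte_fin// ltxx.
have : (s%:E * abs_moment <= (p * s1 + q * s2)%:E * abs_moment)%E.
  rewrite EFinD !EFinM muleDl// ?fin_num_adde_defl//.
  rewrite -!muleA -absZ -(normal_law_abs_moment mX XN s10).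
  rewrite -(normal_law_abs_moment mY YN s20).
  rewrite -!ge0_integralZl//; [|exact: mabs..].
  rewrite -ge0_integralD//; last 4 first.
  - by move=> w _; rewrite mule_ge0.
  - by apply: measurable_funeM; exact: mabs.
  - by move=> w _; rewrite mule_ge0.
  - by apply: measurable_funeM; exact: mabs.
  apply: ge0_le_integral => //.
  - exact: mabs.
  - by apply: emeasurable_funD; apply: measurable_funeM; exact: mabs.
  move=> w _; rewrite /= -!EFinM -EFinD lee_fin ZE mE.
  (* By [mE], [Z - m = p (X - m1) + q (Y - m2)], and the pointwise triangle inequality applies. *)
  rewrite -[in leRHS](ger0_norm p0) -[in leRHS](ger0_norm q0) -!normrM.
  rewrite [X in `|X| <= _](_ : _ = p * (X w - m1) + q * (Y w - m2)) ?ler_normD//.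
  by ring.
have := abs_moment_gt0; rewrite -(fineK abs_fin) lte_fin -!EFinM lee_fin => c0.
by rewrite ler_pM2r.
Qed.

End affine_normal_law.

(** * Linear forms of a Gaussian vector and convexity of the chance set *)

Lemma dotrvE (d : measure_display) (T : measurableType d) (R : realType)
    (P : probability T R) (n : nat) (xi : 'I_n -> {RV P >-> R}) (x : 'cV[R]_n) w :
  dotrv xi x w = \sum_(i < n) x i 0 * xi i w.
Proof. by rewrite /dotrv mxE; apply: eq_bigr => i _; rewrite !mxE. Qed.

Lemma integrable_dotrv (d : measure_display) (T : measurableType d) (R : realType)
    (P : probability T R) (n : nat) (xi : 'I_n -> {RV P >-> R}) (mu : 'cV[R]_n)
    (x : 'cV[R]_n) :
  (forall i, 'E_P[xi i]%E = (mu i 0)%:E) ->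
  P.-integrable setT (EFin \o dotrv xi x).
Proof.
move=> Exi.
have -> : EFin \o dotrv xi x =
    (fun w => \sum_(i < n) ((x i 0)%:E * (xi i w)%:E))%E.
  apply/funext => w; rewrite /= dotrvE -sumEFin.
  by apply: eq_bigr => i _; rewrite EFinM.
apply: integrable_sum => // i _; apply: integrableZl => //.
apply: integrable_fin_integral; first exact/measurable_EFinP.
by rewrite -expectation_def Exi.
Qed.

Lemma prob_normal_law_itv (d : measure_display) (T : measurableType d) (R : realType)
    (P : probability T R) (X : T -> R) m s a b : normal_law P X m s ->
  P [set w | a <= X w <= b] = scaled_prob (a - m) (b - m) s.
Proof.
move=> XN; have := XN `[a, b]%classic (measurable_itv _).
rewrite (_ : X @^-1` _ = [set w | a <= X w <= b]); last first.
  by apply/seteqP; split => w /=; rewrite in_itv.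
move=> ->; congr normal_prob; apply/seteqP; split => z /=;
by rewrite in_itv/= /affineR lerBlDl lerBrDl.
Qed.

Theorem lemma4 (d : measure_display) (T : measurableType d) (R : realType)
    (P : probability T R) (n : nat) (xi : 'I_n -> {RV P >-> R})
    (mu : 'cV[R]_n) (Sigma : 'M[R]_n) (eps : R)
    (Sigma_posdef : posdefmx Sigma)
    (xi_gauss : gaussian_vector xi mu Sigma)
    (eps_gt0 : 0 < eps) (eps_le : eps <= 2^-1) :
  @convex_set R (R^o * R^o * 'cV[R]_n)%type (chance_set xi eps).
Proof.
move=> [[a1 b1] x1] [[a2 b2] x2] k; rewrite !inE /chance_set /=.
case: xi_gauss => gauss Exi _.
set p := k%:num; set q := 1 - k%:num.
have p0 : 0 <= p by rewrite /p.
have q0 : 0 <= q by rewrite subr_ge0; exact: le1.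
have pq1 : p + q = 1 by rewrite addrC subrK.
have [m1 [s1 [s10 N1]]] := gaussian_rv_law (gauss x1).
have [m2 [s2 [s20 N2]]] := gaussian_rv_law (gauss x2).
(* Joint Gaussianity supplies some [m] and [s] here; their relation to the other parameters comes
   from [normal_law_combination]. *)
have [m [s [s0 N]]] := gaussian_rv_law (gauss (p *: x1 + q *: x2)).
have dotrv_comb w :
    dotrv xi (p *: x1 + q *: x2) w = p * dotrv xi x1 w + q * dotrv xi x2 w.
  rewrite !dotrvE !mulr_sumr -big_split; apply: eq_bigr => i _ /=.
  by rewrite !mxE mulrDl !mulrA.
have [mE sle] := normal_law_combination N1 N2 N
  (integrable_dotrv x1 Exi) (integrable_dotrv x2 Exi) dotrv_comb s10 s20 s0 p0 q0.
rewrite (prob_normal_law_itv _ _ N1) (prob_normal_law_itv _ _ N2) => h1 h2.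
change ((1 - eps)%:E <= P [set w | (p * a1 + q * a2
  <= dotrv xi (p *: x1 + q *: x2) w <= p * b1 + q * b2)%R])%E.
rewrite (prob_normal_law_itv _ _ N).
have -> : p * a1 + q * a2 - m = p * (a1 - m1) + q * (a2 - m2) by rewrite mE; ring.
have -> : p * b1 + q * b2 - m = p * (b1 - m1) + q * (b2 - m2) by rewrite mE; ring.
apply: (scaled_prob_convex (t1 := s1) (t2 := s2)) => //; last by rewrite s0.
(* The level [1 - eps] lies in [[1/2, 1]]; the lower bound is where [eps <= 1/2] enters. *)
by apply/andP; split; lra.
Qed.
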